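(* Let $\kappa>0$. Let $(x_i(t),v_i(t))_{i=1}^N$ be the sticky particle solution associated to the initial data $(m_i,x_i^0,v_i^0)_{i=1}^N$. Define $A_N:[-\frac12,\frac12]\to\mathbb{R}$ to be the continuous function, linear on each interval $[\theta_{i-1},\theta_i]$, with $A_N(-\frac12)=0$ and $$A_N'(m)=\psi_i^0:=v_i^0+\sum_{j=1}^Nm_j\Phi(x_i^0-x_j^0)\quad\text{for } m\in(\theta_{i-1},\theta_i),\ i=1,\dots,N,$$ and set $\mathsf{A}_N(m,t)=A_N(m)+\kappa t m^2$. Then the function $$M_N(x,t)=-\frac12+\sum_{i=1}^Nm_iH(x-x_i(t)),\qquad x\in\mathbb{R},\ t\ge0,$$ is not the entropy solution on $\mathbb{R}\times[0,\infty)$ of the discretized balance law $$\partial_tM_N+\partial_x\big(\mathsf{A}_N(M_N,t)\big)=(\phi*M_N)\,\partial_xM_N,\qquad M_N(x,0)=M_N^0(x)=-\frac12+\sum_{i=1}^Nm_iH(x-x_i^0).$$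
   Context: Communication protocol: $\phi:\mathbb{R}\to[0,\infty]$ is nonnegative, even, nonincreasing in $|x|$ and locally integrable, and $\Phi(x)=\int_0^x\phi(y)\,dy$. $H$ is the right-continuous Heaviside function, $H(0)=1$; $\mathrm{sgn}(0)=0$. Sticky particle solution. Given $\kappa\in\mathbb{R}$, masses $m_1,\dots,m_N>0$ with $\sum_i m_i=1$, initial positions $x_1^0\le\cdots\le x_N^0$ and initial velocities $v_1^0,\dots,v_N^0$, consider continuous trajectories $x_i:[0,\infty)\to\mathbb{R}$ with $x_i(0)=x_i^0$, $x_i(t)=x_i^0+\int_0^tv_i$, where $v_i$ is right-continuous with left limits and $v_i(0-):=v_i^0$. Put $J_i(t)=\{j\in\{1,\dots,N\}:x_j(t)=x_i(t)\}$; a time $t$ is a collision time if the cardinality of at least one $J_i$ changes at $t$ (agents that share an initial position are treated as colliding at time $0$). The sticky particle solution is the (globally well-posed) dynamics such that: at non-collision times (a.e.), $$\frac{dx_i}{dt}=v_i,\qquad \frac{dv_i}{dt}=\kappa\sum_{j=1}^Nm_j\,\mathrm{sgn}(x_i-x_j)+\sum_{j=1}^Nm_j\phi(x_j-x_i)(v_j-v_i),$$ with $v_i$ locally absolutely continuous between collision times, terms with $x_j=x_i$ being zero; at collision times momentum is conserved, $\sum_{j\in J_i(t)}m_jv_j(t)=\sum_{j\in J_i(t)}m_jv_j(t-)$; and agents stick, $J_i(s)\subseteq J_i(t)$ for $0\le s\le t$. In particular $x_1(t)\le\cdots\le x_N(t)$ for all $t$, and agents in the same $J_i(t)$ have the same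 velocity. Cumulative masses: $\theta_i=-\frac12+\sum_{j=1}^im_j$, $i=0,\dots,N$. For a nondecreasing $M$ with $M=\pm\frac12$ near $\pm\infty$, $\phi*M$ denotes the continuous function $(\phi*M)(x)=\int_{\mathbb{R}}\Phi(x-y)\,d(\partial_xM)(y)$. Entropy solution. For a flux $\mathsf{A}(m,t)$, Lipschitz in $m$, an entropy pair is a convex Lipschitz $\eta:[-\frac12,\frac12]\to\mathbb{R}$ together with $q$ satisfying $\partial_mq(m,t)=\eta'(m)\partial_m\mathsf{A}(m,t)$, e.g. $q(m,t)=\int_{-1/2}^m\eta'(m')\partial_m\mathsf{A}(m',t)\,dm'$. A function $M:\mathbb{R}\times[0,T]\to[-\frac12,\frac12]$ is an entropy solution of $\partial_tM+\partial_x(\mathsf{A}(M,t))=(\phi*M)\partial_xM$ if (1) for every entropy pair and every nonnegative $\zeta\in C_c^\infty(\mathbb{R}\times(0,T))$, $$\int_0^T\!\!\int_{\mathbb{R}}\big[\eta(M)\partial_t\zeta+q(M,t)\partial_x\zeta+(\phi*M)\,\partial_x(\eta(M))\,\zeta\big]dx\,dt\ge0$$ (with $\partial_x(\eta(M(\cdot,t)))$ a Radon measure); (2) $M(\cdot,t)$ is nondecreasing for every $t$; (3) there is $R(T)>0$ with $M(\pm x,t)=\pm\frac12$ for all $x\ge R(T)$, $t\in[0,T]$. It has initial data $M^0$ if $t\mapsto M(\cdot,t)$ is continuous into $L^1_{\mathrm{loc}}(\mathbb{R})$ with $M(\cdot,0)=M^0$. A function on $\mathbb{R}\times[0,\infty)$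 is an entropy solution if its restriction to every $[0,T]$ is one. *)

(* Defs.v *)
From HB Require Import structures.
From mathcomp Require Import all_boot all_order all_algebra.
From mathcomp Require Import all_classical all_reals all_analysis.

Set Implicit Arguments.
Unset Strict Implicit.
Unset Printing Implicit Defensive.

Import Order.TTheory GRing.Theory Num.Theory.
Import numFieldNormedType.Exports.

Local Open Scope classical_set_scope.
Local Open Scope ring_scope.

Section communication_protocol.
Context {R : realType}.
Implicit Types phi : R -> \bar R.

Definition protocol phi : Prop :=
  [/\ forall x, (0 <= phi x)%E,
      forall x, phi (- x) = phi x,
      forall x y, `|x| <= `|y| -> (phi y <= phi x)%E
    & forall a b, lebesgue_measure.-integrable `[a, b] phi].

(* Oriented integral of [phi] from [0] to [x]. *)
Definition Phi phi (x : R) : R :=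
  if 0 <= x then fine (\int[lebesgue_measure]_(y in `[0%R, x]) phi y)%E
  else - fine (\int[lebesgue_measure]_(y in `[x, 0%R]) phi y)%E.

End communication_protocol.

Section sticky_particles.
Context {R : realType} (N : nat).

Definition initial_configuration (m x0 : 'I_N -> R) : Prop :=
  [/\ forall i, 0 < m i,
      \sum_i m i = 1
    & forall i j : 'I_N, (i <= j)%N -> x0 i <= x0 j].

Definition colocated (x : 'I_N -> R -> R) (t : R) (i : 'I_N) : {set 'I_N} :=
  [set j | x j t == x i t].

(* At time 0 the comparison is with agents that have not yet merged, i.e. with
   singleton clusters: agents sharing an initial position collide at time 0. *)
Definition collision_time (x : 'I_N -> R -> R) (t : R) : Prop :=
  exists i, (t = 0 /\ #|colocated x 0 i| <> 1%N) \/
            (0 < t /\ ~ \forall s \near t, #|colocated x s i| = #|colocated x t i|).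

Definition left_velocity (v0 : 'I_N -> R) (v : 'I_N -> R -> R)
    (i : 'I_N) (t : R) : R :=
  if 0 < t then lim (v i s @[s --> t^'-]) else v0 i.

Definition absolutely_continuous_on (f : R -> R) (a b : R) : Prop :=
  forall e : R, 0 < e -> exists2 d : R, 0 < d &
    forall (n : nat) (l r : 'I_n -> R),
      (forall k, [/\ a <= l k, l k <= r k & r k <= b]) ->
      (forall k k', k != k' -> r k <= l k' \/ r k' <= l k) ->
      \sum_k (r k - l k) < d -> \sum_k `|f (r k) - f (l k)| < e.

(* [phi 0] may be infinite, hence the explicit test. *)
Definition acceleration (phi : R -> \bar R) (kappa : R) (m : 'I_N -> R)
    (x v : 'I_N -> R -> R) (i : 'I_N) (t : R) : R :=
  kappa * (\sum_j m j * Num.sg (x i t - x j t)) +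
  \sum_j (if x j t == x i t then 0
          else m j * fine (phi (x j t - x i t)) * (v j t - v i t)).

Record sticky_particle_solution (phi : R -> \bar R) (kappa : R)
    (m x0 v0 : 'I_N -> R) (x v : 'I_N -> R -> R) : Prop := {
  sticky_x_continuous : forall i, {within `[0, +oo[, continuous (x i)};
  sticky_x_initial : forall i, x i 0 = x0 i;
  sticky_x_integral : forall i t, 0 <= t ->
    x i t = x0 i + \int[lebesgue_measure]_(s in `[0, t]) v i s;
  sticky_v_right_continuous : forall i t, 0 <= t ->
    v i s @[s --> t^'+] --> v i t;
  sticky_v_left_limit : forall i t, 0 < t -> cvg (v i s @[s --> t^'-]);
  sticky_v_initial : ~ collision_time x 0 -> forall i, v i 0 = v0 i;
  sticky_v_absolutely_continuous : forall i a b, 0 <= a -> a < b ->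
    (forall t, a <= t <= b -> ~ collision_time x t) ->
    absolutely_continuous_on (v i) a b;
  sticky_dynamics :
    {ae lebesgue_measure, forall t : R, 0 < t -> ~ collision_time x t ->
       forall i, is_derive t 1 (x i) (v i t) /\
                 is_derive t 1 (v i) (acceleration phi kappa m x v i t)};
  sticky_momentum : forall i t, 0 <= t -> collision_time x t ->
    \sum_(j in colocated x t i) m j * v j t =
    \sum_(j in colocated x t i) m j * left_velocity v0 v j t;
  sticky_sticks : forall i s t, 0 <= s -> s <= t ->
    colocated x s i \subset colocated x t i
}.

End sticky_particles.

Section entropy_solutions.
Context {R : realType}.
Implicit Types (phi : R -> \bar R) (A q M : R -> R -> R) (eta g : R -> R).

Fixpoint C_k (V : normedModType R) (k : nat) (f : V -> R) : Prop :=
  continuous f /\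
  (if k is k'.+1 then
     (forall p v, derivable f p v) /\ (forall v, C_k k' ('D_v f))
   else True).

Definition test_function (V : normedModType R) (U : set V) (f : V -> R) :=
  (forall k, C_k k f) /\
  (exists K, [/\ compact K, K `<=` U & forall p, ~ K p -> f p = 0]).

(* The distributional derivative of [g] is the finite signed measure
   [nup - nun]. *)
Definition distributional_derivative g
    (nup nun : {finite_measure set R -> \bar R}) : Prop :=
  forall psi : R -> R, test_function setT psi ->
    \int[lebesgue_measure]_x (g x * derive1 psi x) =
    - (\int[nup]_x psi x - \int[nun]_x psi x).

(* [phi * M], in terms of the measure [mu] equal to the derivative of [M]. *)
Definition nonlocal_velocity phi (mu : {finite_measure set R -> \bar R})
    (x : R) : R :=
  \int[mu]_y Phi phi (x - y).

Definition state_space : set R := `[- 2^-1, 2^-1].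

(* [A] and [q] take the state first and the time second. The entropy flux is a
   Lipschitz function of the state, determined up to a function of time; the
   derivatives of [eta] and of [A] exist almost everywhere. *)
Definition entropy_pair A (T : R) eta q : Prop :=
  [/\ convex_function state_space eta,
      [lipschitz eta m | m in state_space]
    & forall t : R, 0 <= t <= T ->
        [lipschitz q m t | m in state_space] /\
        {ae lebesgue_measure, forall m : R, - 2^-1 < m < 2^-1 ->
           is_derive m 1 (q^~ t) (derive1 eta m * derive1 (A^~ t) m)}].

(* [mu t] and [nup t - nun t] are the spatial derivatives of [M] and [eta(M)]
   at time [t]; as signed measures they exist and are unique. *)
Definition entropy_inequality phi A M (T : R) : Prop :=
  forall eta q, entropy_pair A T eta q ->
  forall zeta : R * R -> R,
    test_function [set p : R * R | 0 < p.2 < T] zeta ->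
    (forall p, 0 <= zeta p) ->
  forall mu nup nun : R -> {finite_measure set R -> \bar R},
    (forall t : R, 0 < t < T -> distributional_derivative (M^~ t) (mu t) mzero) ->
    (forall t : R, 0 < t < T ->
       distributional_derivative (fun x => eta (M x t)) (nup t) (nun t)) ->
  0 <= \int[lebesgue_measure]_(t in `]0, T[)
    (\int[lebesgue_measure]_x (eta (M x t) * 'D_(0, 1) zeta (x, t) +
                               q (M x t) t * 'D_(1, 0) zeta (x, t)) +
     (\int[nup t]_x (nonlocal_velocity phi (mu t) x * zeta (x, t)) -
      \int[nun t]_x (nonlocal_velocity phi (mu t) x * zeta (x, t)))).

Definition entropy_solution phi A M (T : R) : Prop :=
  [/\ forall x t : R, 0 <= t <= T -> state_space (M x t),
      entropy_inequality phi A M T,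
      forall t : R, 0 <= t <= T -> {homo M^~ t : x y / x <= y}
    & exists2 r, 0 < r & forall x t : R, r <= x -> 0 <= t <= T ->
        M x t = 2^-1 /\ M (- x) t = - 2^-1].

Definition has_initial_data M (M0 : R -> R) (T : R) : Prop :=
  (forall s r : R, 0 <= s <= T -> 0 < r ->
     \int[lebesgue_measure]_(x in `[- r, r]) `|M x t - M x s|
       @[t --> within `[0, T] (nbhs s)] --> 0) /\
  (forall x, M x 0 = M0 x).

Definition global_entropy_solution phi A M (M0 : R -> R) : Prop :=
  forall T : R, 0 < T ->
    entropy_solution phi A M T /\ has_initial_data M M0 T.

End entropy_solutions.

Section discretization.
Context {R : realType} (N : nat).

Definition heaviside (x : R) : R := if 0 <= x then 1 else 0.

Definition empirical_cdf (m y : 'I_N -> R) (x : R) : R :=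
  - 2^-1 + \sum_i m i * heaviside (x - y i).

(* Agents are numbered from 0, so agent [i] occupies [theta i, theta i.+1]. *)
Definition theta (m : 'I_N -> R) (k : nat) : R := - 2^-1 + \sum_(j < N | (j < k)%N) m j.

Definition psi0 (phi : R -> \bar R) (m x0 v0 : 'I_N -> R) (i : 'I_N) : R :=
  v0 i + \sum_j m j * Phi phi (x0 i - x0 j).

(* The values of [A] outside [state_space] are irrelevant. *)
Definition discretized_flux (phi : R -> \bar R) (m x0 v0 : 'I_N -> R)
    (A : R -> R) : Prop :=
  [/\ {within state_space, continuous A},
      A (- 2^-1) = 0
    & forall (i : 'I_N) s, theta m i <= s <= theta m i.+1 ->
        A s = A (theta m i) + psi0 phi m x0 v0 i * (s - theta m i)].

End discretization.

(* Main.v *)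
(* An increasing shock from [a] to [b] is admissible only if the flux lies above
   its chord on [[a, b]], whereas [kappa * t * s ^+ 2] is convex and dominates
   the piecewise linear part of the flux for large [t].
   Sticking makes the cluster of a given agent eventually constant; fix it at a
   late time and let [M] jump from [a] to [b] across it. The entropy
   [(s - a) * (s - b)] vanishes on both sides of the shock, so that, tested near
   the cluster, the time derivative and the nonlocal term disappear whatever the
   velocity of the cluster is, and only the jump [q b - q a] of the entropy flux
   remains. It grows like [kappa * t * (b - a) ^+ 3 / 3], which contradicts the
   entropy inequality. *)
From HB Require Import structures.
Require Import Defs.
From mathcomp Require Import all_boot all_order all_algebra.
From mathcomp Require Import all_classical all_reals all_analysis.
From mathcomp Require Import measurable_realfun ring lra.

Set Implicit Arguments.
Unset Strict Implicit.
Unset Printing Implicit Defensive.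

Import Order.TTheory GRing.Theory Num.Theory.
Import numFieldNormedType.Exports.

Local Open Scope classical_set_scope.
Local Open Scope ring_scope.

(** * Smooth bump functions *)

Section smooth_functions.
Context {R : realType}.

Lemma C_k_continuous (V : normedModType R) k (f : V -> R) :
  C_k k f -> continuous f.
Proof. by case: k => [|k] []. Qed.

Lemma C_kW (V : normedModType R) k (f : V -> R) : C_k k.+1 f -> C_k k f.
Proof.
elim: k f => [|k IH] f [cf [df Df]]; first by [].
by split=> //; split=> // v; apply/IH/Df.
Qed.

Lemma C_k_cst (V : normedModType R) k (c : R) : C_k k (fun _ : V => c).
Proof.
elim: k c => [|k IH] c /=; split=> //; try by move=> x; exact: cvg_cst.
split=> [p v|v]; first exact: derivable_cst.
have -> : 'D_v (fun _ : V => c) = fun=> 0 by apply/funext => x; exact: derive_cst.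
exact: IH.
Qed.

Lemma C_kD (V : normedModType R) k (f g : V -> R) :
  C_k k f -> C_k k g -> C_k k (fun p => f p + g p).
Proof.
elim: k f g => [|k IH] f g [cf Hf] [cg Hg].
  by split=> // x; apply: cvgD; [exact: cf|exact: cg].
split; first by move=> x; apply: cvgD; [exact: cf|exact: cg].
move: Hf Hg => [df Df] [dg Dg].
split=> [p v|v]; first by apply: derivableD; [exact: df|exact: dg].
have -> : 'D_v (fun p => f p + g p) = fun p => 'D_v f p + 'D_v g p.
  by apply/funext => x; rewrite (deriveD (df x v) (dg x v)).
by apply: IH; [exact: Df|exact: Dg].
Qed.

Lemma C_kM (V : normedModType R) k (f g : V -> R) :
  C_k k f -> C_k k g -> C_k k (fun p => f p * g p).
Proof.
elim: k f g => [|k IH] f g Cf Cg; have cf := C_k_continuous Cf;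
  have cg := C_k_continuous Cg.
  by split=> // x; apply: cvgM; [exact: cf|exact: cg].
split; first by move=> x; apply: cvgM; [exact: cf|exact: cg].
have [fk gk] := (C_kW Cf, C_kW Cg).
move: Cf Cg => [_ [df Df]] [_ [dg Dg]].
split=> [p v|v]; first by apply: derivableM; [exact: df|exact: dg].
have -> : 'D_v (fun p => f p * g p) = fun p => f p * 'D_v g p + g p * 'D_v f p.
  by apply/funext => x; rewrite (deriveM (df x v) (dg x v)).
by apply: C_kD; [exact: (IH f ('D_v g) fk (Dg v))|exact: (IH g ('D_v f) gk (Df v))].
Qed.

(** Along [v], the difference quotient of [f \o L] is, as a function of [h], the one of [f] along
    [l v]. Derivability and the value of the derivative therefore transfer together. *)
Lemma derive_comp_affine (V : normedModType R) (f : R -> R) (L l : V -> R) v p :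
  (forall h, L (h *: v + p) = h * l v + L p) ->
  (derivable (f \o L) p v = derivable f (L p) (l v)) *
  ('D_v (f \o L) p = 'D_(l v) f (L p)).
Proof.
move=> Ll; rewrite /derivable /derive.
suff -> : (fun h : R => h^-1 *: (((f \o L) \o shift p) (h *: v) - (f \o L) p)) =
  (fun h : R => h^-1 *: ((f \o shift (L p)) (h *: l v) - f (L p))) by [].
by apply/funext => h /=; rewrite Ll.
Qed.

Lemma C_k_comp_affine (V : normedModType R) k (f : R -> R) (L l : V -> R) :
  (forall p v h, L (h *: v + p) = h * l v + L p) -> continuous L ->
  C_k k f -> C_k k (f \o L).
Proof.
move=> Ll cL; elim: k f => [|k IH] f [cf Hf].
  by split=> // x; apply: continuous_comp; [exact: cL|exact: cf].
split; first by move=> x; apply: continuous_comp; [exact: cL|exact: cf].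
move: Hf => [df Df].
split=> [p v|v]; first by rewrite (derive_comp_affine f (Ll p v)).
have -> : 'D_v (f \o L) = 'D_(l v) f \o L.
  by apply/funext => p /=; rewrite (derive_comp_affine f (Ll p v)).
by apply: (IH ('D_(l v) f)); exact: Df.
Qed.

(** On the line the derivative in direction [v] is [v * f'], so one scalar derivative controls all
    directions required by [C_k]. *)
Lemma C_kS_derive1 k (f f' : R -> R) :
  (forall x : R, is_derive x 1 f (f' x)) -> C_k k f' -> C_k k.+1 f.
Proof.
move=> ff' Ck; have df x : differentiable f x.
  by apply/derivable1_diffP; exact: ex_derive.
have Dv v x : 'D_v f x = v * f' x.
  rewrite deriveE// -[v in LHS]mulr1 -[v * 1]/(v *: (1 : R)) linearZ /=.
  by rewrite -deriveE//; have [_ ->] := ff' x.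
split; first by move=> x; exact: differentiable_continuous.
split=> [p v|v]; first exact: diff_derivable.
have -> : 'D_v f = fun x => v * f' x by apply/funext => x; exact: Dv.
by apply: C_kM => //; exact: C_k_cst.
Qed.

(* Differentiation maps [flat P] to [flat ('X^2 * (P - P^`()))], so this family is
   smooth although it is glued at 0. *)
Definition flat (P : {poly R}) (x : R) : R :=
  if 0 < x then P.[x^-1] * expR (- x^-1) else 0.

(** The exponential series bounds each monomial [y ^+ i * expR (- y)] by [i!]; the coefficients are
    then summed. *)
Lemma horner_expRN_bounded (P : {poly R}) :
  exists C : R, forall y, 0 <= y -> `|P.[y] * expR (- y)| <= C.
Proof.
have key i (y : R) : 0 <= y -> y ^+ i * expR (- y) <= i`!%:R.
  move=> y0; rewrite expRN ler_pdivrMr ?expR_gt0//.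
  case: i => [|i]; first by rewrite expr0 mul1r (le_trans _ (expR_ge1Dx y))// lerDl.
  have f0 : 0 < i.+1`!%:R :> R by rewrite ltr0n fact_gt0.
  have := expR_ge1Dxn i y0; rewrite -(ler_pM2l f0); apply: le_trans.
  by rewrite mulrDr mulr1 mulrCA divff ?gt_eqF// mulr1 lerDr ltW.
exists (\sum_(i < size P) `|P`_i| * i`!%:R) => y y0.
rewrite horner_coef mulr_suml (le_trans (ler_norm_sum _ _ _))//.
apply: ler_sum => i _; rewrite -mulrA normrM ler_wpM2l//.
by rewrite ger0_norm ?key// mulr_ge0 ?exprn_ge0 ?expR_ge0.
Qed.

(** The previous bound, for [P * 'X^2] at [x^-1], gains a factor [x ^+ 2]. This makes the difference
    quotient at 0 of order [h]. *)
Lemma flat_quadratic (P : {poly R}) :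
  exists C : R, 0 <= C /\ forall x, `|flat P x| <= C * x ^+ 2.
Proof.
have [C HC] := horner_expRN_bounded (P * 'X^2).
exists `|C|; split=> // x; rewrite /flat; case: ifPn => [x0|_]; last first.
  by rewrite normr0 mulr_ge0 ?sqr_ge0.
have xV0 : 0 <= x^-1 by rewrite invr_ge0 ltW.
move: (HC _ xV0).
rewrite hornerM hornerXn exprVn mulrAC normrM normfV (ger0_norm (sqr_ge0 x)).
rewrite ler_pdivrMr ?exprn_gt0// => /le_trans; apply.
by rewrite ler_wpM2r ?sqr_ge0// ler_norm.
Qed.

Lemma is_derive_flat (P : {poly R}) (x : R) :
  is_derive x 1 (flat P) (flat ('X^2 * (P - P^`())) x).
Proof.
have [x0|x0|->] := ltrgt0P x.
- apply: (@near_eq_is_derive R R R (fun y => P.[y^-1] * expR (- y^-1))).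
    near=> y; rewrite /flat ifT//; near: y; exact: lt_nbhsr.
  have Dinv : is_derive x 1 (fun y : R => y^-1) (- x ^- 2).
    have := @is_deriveV R id x 1 1; rewrite gt_eqF//= => /(_ isT (is_derive_id _ _)).
    by rewrite /GRing.scale/= mulr1.
  have D1 := @is_derive1_comp R (fun y => P.[y]) GRing.inv x _ _
    (is_derive_poly P _) Dinv.
  have D2 := @is_derive1_comp R expR (fun y => - y^-1) x _ _ (is_derive_expR _)
    (is_deriveN Dinv).
  have D := is_deriveM D1 D2.
  apply: (is_derive_eq D).
  rewrite /flat x0 hornerM hornerXn hornerD hornerN -!exprVn /GRing.scale/=; ring.
- apply: (@near_eq_is_derive R R R (cst 0)).
    near=> y; rewrite /flat ifN// -leNgt ltW//; near: y; exact: lt_nbhsl.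
  rewrite /flat ifN ?le_gtF// -?leNgt ?ltW//; exact: is_derive_cst.
(* At the gluing point the quadratic bound forces the difference quotient to 0. *)
rewrite {2}/flat ltxx; have [C [C0 HC]] := flat_quadratic P.
have lim0 : (fun h : R =>
    h^-1 *: ((flat P \o shift 0) (h *: (1 : R)) - flat P 0)) @ 0^' --> (0 : R).
  apply/cvgr0Pnorm_le => e e0; near=> h.
  rewrite {2}/flat ltxx subr0 /= addr0 /GRing.scale/= mulr1 normrM normfV.
  have h0 : h != 0 by near: h; exact: nbhs_dnbhs_neq.
  rewrite ler_pdivrMl ?normr_gt0// (le_trans (HC h))//.
  rewrite -real_normK ?num_real// expr2 mulrCA ler_wpM2l//.
  (* [C] may be 0; [C + 1] can be divided by. *)
  rewrite (@le_trans _ _ ((C + 1) * `|h|))//; first by rewrite ler_wpM2r// lerDl.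
  rewrite -ler_pdivlMl ?ltr_wpDl//; near: h; apply: dnbhs0_le.
  by rewrite mulr_gt0// invr_gt0 ltr_wpDl.
apply: DeriveDef; first by apply/cvg_ex; exists 0.
exact: cvg_lim lim0.
Unshelve. all: end_near. Qed.

End smooth_functions.

Section bump_functions.
Context {R : realType}.

Lemma flat_C_k k (P : {poly R}) : C_k k (flat P).
Proof.
elim: k P => [|k IH] P; last exact: C_kS_derive1 (@is_derive_flat R P) (IH _).
split=> // x; apply: differentiable_continuous.
by apply/derivable1_diffP; apply: ex_derive; exact: is_derive_flat.
Qed.

Lemma flat0 (P : {poly R}) (x : R) : x <= 0 -> flat P x = 0.
Proof. by move=> x0; rewrite /flat ltNge x0. Qed.

Lemma flat1_gt0 (x : R) : 0 < x -> 0 < flat 1 x.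
Proof. by move=> x0; rewrite /flat x0 hornerC mul1r expR_gt0. Qed.

Lemma flat1_ge0 (x : R) : 0 <= flat 1 x.
Proof.
by have [/flat0 ->|/flat1_gt0/ltW] := leP x 0.
Qed.

Lemma flat1_homo : {homo @flat R 1 : x y / x <= y}.
Proof.
move=> x y xy; have [x0|x0] := leP x 0; first by rewrite flat0 ?flat1_ge0.
have y0 := lt_le_trans x0 xy.
by rewrite /flat x0 y0 !hornerC !mul1r ler_expR lerN2 lef_pV2.
Qed.

Definition smooth_bump (l r x : R) : R := flat 1 (x - l) * flat 1 (r - x).

(** The derivative of [smooth_bump l r], because [flat 1] has derivative [flat 'X^2]. *)
Definition smooth_bump' (l r x : R) : R :=
  flat 'X^2 (x - l) * flat 1 (r - x) - flat 1 (x - l) * flat 'X^2 (r - x).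

Lemma smooth_bump_ge0 l r x : 0 <= smooth_bump l r x.
Proof. by rewrite mulr_ge0 ?flat1_ge0. Qed.

(** Both factors are at least [flat 1 e] by monotonicity. This uniform bound will make the time
    integral of the entropy production strictly signed. *)
Lemma smooth_bump_lb l r x (e : R) : l + e <= x -> x <= r - e ->
  flat 1 e ^+ 2 <= smooth_bump l r x.
Proof.
move=> lx xr; rewrite expr2 ler_pM ?flat1_ge0// flat1_homo//; lra.
Qed.

Lemma smooth_bump_out l r x : ~~ (l < x < r) -> smooth_bump l r x = 0.
Proof.
rewrite negb_and -!leNgt /smooth_bump => /orP[xl|rx].
  by rewrite [flat 1 (x - l)]flat0 ?mul0r// subr_le0.
by rewrite [flat 1 (r - x)]flat0 ?mulr0// subr_le0.
Qed.

Lemma smooth_bump'_out l r x : ~~ (l < x < r) -> smooth_bump' l r x = 0.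
Proof.
rewrite negb_and -!leNgt /smooth_bump' => /orP[xl|rx].
  by rewrite ![flat _ (x - l)]flat0 ?mul0r ?subr0// subr_le0.
by rewrite ![flat _ (r - x)]flat0 ?mulr0 ?subr0// subr_le0.
Qed.

Lemma smooth_bump_C_k k l r : C_k k (smooth_bump l r).
Proof.
apply: C_kM.
  apply: (@C_k_comp_affine R R k (flat 1) (fun x => x - l) id); last exact: flat_C_k.
    by move=> p v h; rewrite addrA.
  by move=> x; apply: cvgB; [exact: cvg_id|exact: cvg_cst].
apply: (@C_k_comp_affine R R k (flat 1) (fun x => r - x) -%R); last exact: flat_C_k.
  by move=> p v h; rewrite /GRing.scale/=; ring.
by move=> x; apply: cvgB; [exact: cvg_cst|exact: cvg_id].
Qed.

Lemma is_derive_bump (l r x : R) : is_derive x 1 (smooth_bump l r) (smooth_bump' l r x).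
Proof.
have e1 : 'X^2 * ((1 : {poly R}) - 1^`()) = 'X^2 by rewrite derivC subr0 mulr1.
have dl : is_derive x 1 (fun x : R => x - l) 1.
  have := @is_deriveB R R R id (cst l) x 1 1 0 (is_derive_id _ _) (is_derive_cst _ _ _).
  by rewrite subr0.
have dr : is_derive x 1 (fun x : R => r - x) (- 1).
  have := @is_deriveB R R R (cst r) id x 1 0 1 (is_derive_cst _ _ _) (is_derive_id _ _).
  by rewrite sub0r.
have := @is_derive1_comp R (flat 1) _ x _ _ (is_derive_flat 1 _) dl.
have := @is_derive1_comp R (flat 1) _ x _ _ (is_derive_flat 1 _) dr.
rewrite !e1 => Dr Dl; apply: (is_derive_eq (is_deriveM Dl Dr)).
by rewrite /smooth_bump' /GRing.scale/=; ring.
Qed.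

Lemma test_function_bump l r (b d : R) (U : set (R * R)) :
  `[l, r] `*` `[b, d] `<=` U ->
  test_function U (fun p : R * R => smooth_bump l r p.1 * smooth_bump b d p.2).
Proof.
move=> KU; split=> [k|].
  apply: C_kM.
    apply: (@C_k_comp_affine R (R * R)%type k (smooth_bump l r) fst fst)
      (smooth_bump_C_k k l r) => //.
    by move=> x; exact: cvg_fst.
  apply: (@C_k_comp_affine R (R * R)%type k (smooth_bump b d) snd snd)
    (smooth_bump_C_k k b d) => //.
  by move=> x; exact: cvg_snd.
exists (`[l, r] `*` `[b, d]); split=> //.
  by apply: compact_setX; exact: segment_compact.
move=> [x t] /= H; have [xlr|/smooth_bump_out ->] := boolP (l < x < r);
  last by rewrite mul0r.
have [tbd|/smooth_bump_out ->] := boolP (b < t < d); last by rewrite mulr0.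
exfalso; apply: H; rewrite /= !in_itv/=.
by move: xlr tbd => /andP[/ltW -> /ltW ->] /andP[/ltW -> /ltW ->].
Qed.

Lemma derive_bump_space l r (b d x t : R) :
  'D_(1, 0) (fun p : R * R => smooth_bump l r p.1 * smooth_bump b d p.2) (x, t) =
  smooth_bump' l r x * smooth_bump b d t.
Proof.
have [D1 D1E] := is_derive_bump l r x.
have A1 := @derive_comp_affine R (R * R)%type (smooth_bump l r) fst fst (1, 0)
  (x, t) (fun=> erefl).
have A2 := @derive_comp_affine R (R * R)%type (smooth_bump b d) snd snd (1, 0)
  (x, t) (fun=> erefl).
rewrite (@deriveM _ _ (smooth_bump l r \o fst) (smooth_bump b d \o snd)).
- by rewrite A1 A2 /= derive0 D1E /GRing.scale/= mulr0 add0r mulrC.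
- by rewrite A1.
- by rewrite A2; exact: derivable0.
Qed.

Lemma derive_bump_time l r (b d x t : R) :
  'D_(0, 1) (fun p : R * R => smooth_bump l r p.1 * smooth_bump b d p.2) (x, t) =
  smooth_bump l r x * smooth_bump' b d t.
Proof.
have [D1 D1E] := is_derive_bump b d t.
have A1 := @derive_comp_affine R (R * R)%type (smooth_bump l r) fst fst (0, 1)
  (x, t) (fun=> erefl).
have A2 := @derive_comp_affine R (R * R)%type (smooth_bump b d) snd snd (0, 1)
  (x, t) (fun=> erefl).
rewrite (@deriveM _ _ (smooth_bump l r \o fst) (smooth_bump b d \o snd)).
- by rewrite A1 A2 /= derive0 D1E /GRing.scale/= mulr0 addr0.
- by rewrite A1; exact: derivable0.
- by rewrite A2.
Qed.

Lemma test_function_measurable (psi : R -> R) :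
  test_function setT psi -> measurable_fun setT psi.
Proof.
move=> [Cpsi _]; apply: continuous_measurable_fun.
exact: (@C_k_continuous R R 0 _ (Cpsi 0%N)).
Qed.

Lemma flat1_le1 (x : R) : flat 1 x <= 1.
Proof.
rewrite /flat; case: ifPn => // x0.
by rewrite hornerC mul1r -expR0 ler_expR oppr_le0 invr_ge0 ltW.
Qed.

Lemma smooth_bump_le1 (l r x : R) : smooth_bump l r x <= 1.
Proof. by rewrite mulr_ile1 ?flat1_ge0 ?flat1_le1. Qed.

Lemma test_function_bump1 (l r : R) : test_function setT (smooth_bump l r).
Proof.
split=> [k|]; first exact: smooth_bump_C_k.
exists [set` `[l, r]]; split=> //; first exact: segment_compact.
move=> x /= H; apply: smooth_bump_out; apply/negP => /andP[/ltW lx /ltW xr]; apply: H.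
by rewrite in_itv/= lx.
Qed.

Lemma derive1_bump (l r x : R) : derive1 (smooth_bump l r) x = smooth_bump' l r x.
Proof. by rewrite derive1E (derive_val (is_derive := is_derive_bump l r x)). Qed.

Lemma smooth_bump_measurable (l r : R) : measurable_fun setT (smooth_bump l r).
Proof. exact: test_function_measurable (test_function_bump1 l r). Qed.

End bump_functions.

(** * Step functions and atomic measures *)

Section step_functions.
Context {R : realType}.

Lemma test_function_support (psi : R -> R) : test_function setT psi ->
  exists B : R, forall x, B <= `|x| -> psi x = 0 /\ derive1 psi x = 0.
Proof.
move=> [_ [K [cK _ psi0]]].
have [B [_ KB]] := compact_bounded cK.
have {}psi0 (x : R) : `|B| + 1 <= `|x| -> psi x = 0.
  move=> Bx; apply: psi0 => Kx; have B1 : B < `|B| + 2^-1.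
    by rewrite (le_lt_trans (ler_norm B))// ltrDl invr_gt0.
  have xB : `|x| <= `|B| + 2^-1 := KB _ B1 _ Kx; lra.
(* The extra margin makes [psi] vanish on a neighbourhood of [x], hence also its derivative at
   [x]. *)
exists (`|B| + 2) => x Bx; split; first by apply: psi0; lra.
rewrite derive1E (@near_eq_derive R R R _ (cst 0)) ?derive_cst//.
have /cvgr_norm_gt : (z : R) @[z --> x] --> x by exact: cvg_id.
have Bx' : `|B| + 1 < `|x| by lra.
by move=> /(_ _ Bx'); apply: filterS => z /ltW; exact: psi0.
Qed.

(** The derivative of a Heaviside step is a Dirac mass: the integral reduces to a segment from [y]
    to a point beyond the support of [psi], where the fundamental theorem of calculus leaves
    [- psi y]. Integrability is recorded for the additivity used in [step_derive]. *)
Lemma heaviside_derive (psi : R -> R) (y : R) : test_function setT psi ->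
  lebesgue_measure.-integrable setT
    (EFin \o (fun x => heaviside (x - y) * derive1 psi x)) /\
  \int[lebesgue_measure]_x (heaviside (x - y) * derive1 psi x) = - psi y.
Proof.
move=> tpsi; have [B psiB] := test_function_support tpsi.
have [Cpsi _] := tpsi.
have [_ [dpsi Dpsi]] := Cpsi 1%N.
have cdpsi : continuous (derive1 psi).
  have -> : derive1 psi = 'D_1 psi by apply/funext => x; rewrite derive1E.
  exact: (@C_k_continuous R R 0 _ (Dpsi 1)).
pose B' : R := Num.max (`|y| + 1) B.
have psi0 (x : R) : B' <= x -> psi x = 0 /\ derive1 psi x = 0.
  rewrite ge_max => /andP[_ Bx]; apply: psiB; exact: le_trans (ler_norm x).
have yB : y < B' by rewrite lt_max (le_lt_trans (ler_norm y))// ltrDl.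
have E : (fun x => heaviside (x - y) * derive1 psi x) = (derive1 psi) \_ `[y, B'].
  apply/funext => x; rewrite /patch mem_setE in_itv/= /heaviside subr_ge0.
  have [yx|_] := leP y x; last by rewrite mul0r.
  by have [_|/ltW/psi0[_ ->]] := leP x B'; rewrite ?mul1r ?mulr0.
have cw : {within `[y, B'], continuous (derive1 psi)}.
  exact: continuous_subspaceT.
split.
  rewrite E -restrict_EFin -integrable_mkcond//.
  by apply: continuous_compact_integrable; [exact: segment_compact|exact: cw].
rewrite E -Rintegral_mkcond /Rintegral.
rewrite (continuous_FTC2 (F := psi) yB cw) //=.
  by have [-> _] := psi0 _ (lexx B'); rewrite sub0r.
have cpsi : continuous psi by exact: (@C_k_continuous R R 0 _ (Cpsi 0%N)).
split=> [x _||]; first exact: dpsi.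
- exact: cvg_at_right_filter (cpsi _).
- exact: cvg_at_left_filter (cpsi _).
Qed.

(** A pair is a weight and a position, so that one list encodes both a step function and its atomic
    derivative. *)
Definition step (s : seq (R * R)) (x : R) : R :=
  \sum_(p <- s) p.1 * heaviside (x - p.2).

Lemma step_derive (psi : R -> R) (s : seq (R * R)) (c : R) :
  test_function setT psi ->
  lebesgue_measure.-integrable setT
    (EFin \o (fun x => (c + step s x) * derive1 psi x)) /\
  \int[lebesgue_measure]_x ((c + step s x) * derive1 psi x) =
  - \sum_(p <- s) p.1 * psi p.2.
Proof.
move=> tpsi; elim: s => [|p s [I1 I2]].
  (* Against [derive1 psi], the constant [c] acts as [c] times a Heaviside step placed to the left
     of the support, at a point where [psi] is 0. *)
  have [B psiB] := test_function_support tpsi.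
  have [J1 J2] := heaviside_derive (- `|B|) tpsi.
  have [p0 _] : psi (- `|B|) = 0 /\ derive1 psi (- `|B|) = 0.
    by apply: psiB; rewrite normrN normr_id ler_norm.
  have E : (fun x => (c + step [::] x) * derive1 psi x) =
      (fun x => c * (heaviside (x - - `|B|) * derive1 psi x)).
    apply/funext => x; rewrite /step big_nil addr0 /heaviside opprK.
    case: ifPn; rewrite ?mul1r// -ltNge => xB; have [|_ ->] := psiB x; rewrite ?mulr0//.
    have := ler_norm B; have := ler_norm (- x); rewrite normrN; lra.
  rewrite E; split.
    exact: (integrableZl measurableT c J1).
  by rewrite RintegralZl// J2 p0 oppr0 mulr0 big_nil oppr0.
have [J1 J2] := heaviside_derive p.2 tpsi.
have E : (fun x => (c + step (p :: s) x) * derive1 psi x) =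
    (fun x => (c + step s x) * derive1 psi x +
              p.1 * (heaviside (x - p.2) * derive1 psi x)).
  by apply/funext => x; rewrite /step big_cons; ring.
have J1' : lebesgue_measure.-integrable setT
    (EFin \o (fun x => p.1 * (heaviside (x - p.2) * derive1 psi x))).
  exact: (integrableZl measurableT p.1 J1).
rewrite E; split.
  exact: (integrableD measurableT I1 J1').
by rewrite RintegralD// I2 RintegralZl// J2 big_cons; ring.
Qed.

Section finite_measure_add.
Variables (m1 m2 : {finite_measure set R -> \bar R}).

(** [measure_add] repackaged with its finiteness, since [distributional_derivative] speaks of finite
    measures. *)
Definition finite_measure_add : set R -> \bar R := measure_add m1 m2.

HB.instance Definition _ := Measure.copy finite_measure_add
  (msum (fun n => if n is 0%N then m1 : {measure set R -> \bar R} else m2) 2).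

Let finite_measure_add_fin : fin_num_fun finite_measure_add.
Proof.
move=> A mA; rewrite /finite_measure_add measure_addE fin_numD.
by rewrite !fin_num_measure.
Qed.

HB.instance Definition _ :=
  Measure_isFinite.Build _ _ _ finite_measure_add finite_measure_add_fin.

End finite_measure_add.

(** Induction on the list, adding one scaled Dirac mass at a time. For nonnegative integrands the
    integral is additive in the measure without integrability. *)
Lemma atomic_measure_ge0 (s : seq (R * R)) : all (fun p => 0 <= p.1) s ->
  exists mu : {finite_measure set R -> \bar R}, forall f : R -> R,
    measurable_fun setT f -> (forall x, 0 <= f x) ->
    (\int[mu]_x (f x)%:E = (\sum_(p <- s) p.1 * f p.2)%:E)%E.
Proof.
elim: s => [_|[c y] s IH /= /andP[c0 /IH[mu muE]]].
  by exists mzero => f mf f0; rewrite integral_measure_zero big_nil.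
exists (finite_measure_add (mscale (NngNum c0) \d_y) mu) => f mf f0.
have mf' := (measurable_EFinP _ _).2 mf.
have f0' (x : R) : setT x -> (0 <= (EFin \o f) x)%E by rewrite /= lee_fin.
rewrite [LHS]ge0_integral_measure_add// muE// ge0_integral_mscale//.
by rewrite integral_dirac//= diracT mul1e big_cons EFinD.
Qed.

(** The positive and negative parts of [f] fall under the nonnegative case and have finite
    integrals, so these can be subtracted. *)
Lemma atomic_measure (s : seq (R * R)) : all (fun p => 0 <= p.1) s ->
  exists mu : {finite_measure set R -> \bar R}, forall f : R -> R,
    measurable_fun setT f ->
    \int[mu]_x f x = \sum_(p <- s) p.1 * f p.2.
Proof.
move=> /atomic_measure_ge0[mu muE]; exists mu => f mf.
rewrite /Rintegral integralE.
have -> : (fun x => (f x)%:E)^\+%E = (fun x => (Num.max (f x) 0)%:E).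
  by apply/funext => x; rewrite funeposE EFin_max.
have -> : (fun x => (f x)%:E)^\-%E = (fun x => (Num.max (- f x) 0)%:E).
  by apply/funext => x; rewrite funenegE EFin_max.
rewrite !muE; try by move=> x; rewrite le_max lexx orbT.
- rewrite -EFinB /= -sumrB; apply: eq_bigr => p _; rewrite -mulrBr; congr (_ * _).
  by rewrite /Num.max; case: ifPn; case: ifPn; rewrite -?leNgt; lra.
- by apply: measurable_maxr => //; exact: measurableT_comp.
- exact: measurable_maxr.
Qed.

(* Integrability excludes the junk value [fine +oo = 0]. *)
Lemma Rintegral_itv_gt0 (T u w c : R) (h : R -> R) :
  0 < u -> u < w -> w < T -> 0 < c ->
  lebesgue_measure.-integrable `]0, T[ (EFin \o h) ->
  (forall t, 0 < t < T -> 0 <= h t) ->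
  (forall t, u <= t <= w -> c <= h t) ->
  0 < \int[lebesgue_measure]_(t in `]0, T[) h t.
Proof.
move=> u0 uw wT c0 ih h0 hc.
have sub : [set` `[u, w]] `<=` [set` `]0, T[].
  by apply: subset_itv; rewrite bnd_simp.
have h0' (t : R) : [set` `]0, T[] t -> (0 <= (h t)%:E)%E.
  by rewrite /= in_itv/= lee_fin; exact: h0.
have mh := measurable_int _ ih.
rewrite -lte_fin fineK ?integrable_fin_num//.
apply: (@lt_le_trans _ _ (c * (w - u))%:E).
  by rewrite lte_fin mulr_gt0// subr_gt0.
apply: (@le_trans _ _ (\int[lebesgue_measure]_(t in `[u, w]) (h t)%:E)%E); last first.
  exact: ge0_subset_integral.
have -> : ((c * (w - u))%:E = \int[lebesgue_measure]_(t in `[u, w]) c%:E)%E.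
  by rewrite integral_cst//= lebesgue_measure_itv/= lte_fin uw -EFinD -EFinM.
apply: ge0_le_integral => //.
- by move=> t _; rewrite lee_fin ltW.
- exact: measurable_funS mh.
Qed.

End step_functions.

(** * Measurability of the nonlocal velocity *)

Section velocity.
Context {R : realType}.
Variables (phi : R -> \bar R) (hphi : protocol phi).

Lemma integral_protocol_homo (a b c d : R) : c <= a -> b <= d ->
  fine (\int[lebesgue_measure]_(y in `[a, b]) phi y)%E <=
  fine (\int[lebesgue_measure]_(y in `[c, d]) phi y)%E.
Proof.
move=> ca bd; have [phi0 _ _ phiI] := hphi.
have fn u w : (\int[lebesgue_measure]_(y in `[u, w]) phi y)%E \is a fin_num.
  exact: integrable_fin_num.
apply: fine_le => //; apply: ge0_subset_integral => //.
  exact: measurable_int (phiI c d).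
by apply: subset_itv; rewrite bnd_simp.
Qed.

Lemma Phi_homo : {homo Phi phi : x y / x <= y}.
Proof.
have [phi0 _ _ _] := hphi.
have i0 a b : 0 <= fine (\int[lebesgue_measure]_(y in `[a, b]) phi y)%E.
  by apply: fine_ge0; exact: integral_ge0.
move=> x y xy; rewrite /Phi; case: (leP 0 x) => x0; case: (leP 0 y) => y0.
- exact: integral_protocol_homo.
- by have := le_lt_trans x0 (le_lt_trans xy y0); rewrite ltxx.
- by rewrite (@le_trans _ _ 0)// oppr_le0.
- by rewrite lerN2 integral_protocol_homo.
Qed.

Lemma measurable_Phi : measurable_fun setT (Phi phi).
Proof. by apply: nondecreasing_measurable => //; exact: Phi_homo. Qed.

(** For an atomic measure the velocity is a finite combination of translates of [Phi phi], each
    measurable because [Phi phi] is nondecreasing. *)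
Lemma measurable_nonlocal_velocity (mu : {finite_measure set R -> \bar R})
    (s : seq (R * R)) :
  (forall f : R -> R, measurable_fun setT f ->
    \int[mu]_x f x = \sum_(p <- s) p.1 * f p.2) ->
  measurable_fun setT (nonlocal_velocity phi mu).
Proof.
move=> muE.
have -> : nonlocal_velocity phi mu = fun x => \sum_(p <- s) p.1 * Phi phi (x - p.2).
  apply/funext => x; rewrite /nonlocal_velocity.
  rewrite (muE (fun y => Phi phi (x - y)))//.
  by apply: (measurableT_comp measurable_Phi); exact: measurable_funB.
elim: s {muE} => [|p s IH].
  by under eq_fun do rewrite big_nil; exact: measurable_cst.
under eq_fun do rewrite big_cons; apply: measurable_funD => //.
apply: measurable_funM => //; apply: (measurableT_comp measurable_Phi).
exact: measurable_funB.
Qed.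

End velocity.

(** * A quadratic entropy pair *)

Section entropy.
Context {R : realType}.

Lemma lipschitzI (f : R -> R) (D : set R) (C : R) :
  (forall x y, D x -> D y -> `|f x - f y| <= C * `|x - y|) ->
  [lipschitz f m | m in D].
Proof.
move=> H; have : \forall M \near +oo, C <= M by exact: nbhs_pinfty_ge (num_real _).
apply: filterS => M CM [x y] [/= Dx Dy].
by rewrite (le_trans (H _ _ Dx Dy))// ler_wpM2r.
Qed.

Definition chord (a b s : R) : R := (s - a) * (s - b).

Definition clamp (l u s : R) : R := Num.min u (Num.max l s).

(* A primitive of [s * (chord a b)'(s)]; times [2 * kappa * t], it is the entropy
   flux of [kappa * t * s ^+ 2]. *)
Definition quad_flux (a b s : R) : R := 2 / 3 * s ^+ 3 - (a + b) / 2 * s ^+ 2.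

Lemma state_spaceP (s : R) : state_space s <-> - 2^-1 <= s <= 2^-1.
Proof. by rewrite /state_space /= in_itv. Qed.

Lemma clamp_lip (l u x y : R) : `|clamp l u x - clamp l u y| <= `|x - y|.
Proof.
have := ler_norm (x - y); have := ler_norm (y - x); rewrite (distrC y x) => h1 h2.
rewrite ler_norml; rewrite /clamp !minEle !maxEle.
by repeat case: ifPn; rewrite -?ltNge => *; apply/andP; split; lra.
Qed.

Lemma clamp_itv (l u s : R) : l <= u -> l <= clamp l u s <= u.
Proof.
move=> lu; rewrite /clamp minEle maxEle.
by repeat case: ifPn; rewrite -?ltNge => *; apply/andP; split; lra.
Qed.

Lemma clamp_left (l u s : R) : l <= u -> s <= l -> clamp l u s = l.
Proof. by move=> lu sl; rewrite /clamp max_l// min_r. Qed.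

Lemma clamp_right (l u s : R) : l <= u -> u <= s -> clamp l u s = u.
Proof. by move=> lu us; rewrite /clamp max_r ?(le_trans lu)// min_l. Qed.

Lemma clamp_id (l u s : R) : l <= s <= u -> clamp l u s = s.
Proof. by move=> /andP[ls su]; rewrite /clamp max_r// min_r. Qed.

Section pair.
Variables (a b : R) (ha : - 2^-1 <= a <= 2^-1) (hb : - 2^-1 <= b <= 2^-1).

Lemma chord_lip (x y : R) : - 2^-1 <= x <= 2^-1 -> - 2^-1 <= y <= 2^-1 ->
  `|chord a b x - chord a b y| <= 2 * `|x - y|.
Proof.
move=> hx hy; have -> : chord a b x - chord a b y = (x + y - a - b) * (x - y).
  by rewrite /chord; ring.
rewrite normrM ler_wpM2r// ler_norml.
move: ha hb hx hy => /andP[? ?] /andP[? ?] /andP[? ?] /andP[? ?].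
by apply/andP; split; lra.
Qed.

Lemma quad_flux_lip (x y : R) : - 2^-1 <= x <= 2^-1 -> - 2^-1 <= y <= 2^-1 ->
  `|quad_flux a b x - quad_flux a b y| <= `|x - y|.
Proof.
move=> hx hy; have -> : quad_flux a b x - quad_flux a b y =
    (2 / 3 * (x ^+ 2 + x * y + y ^+ 2) - (a + b) / 2 * (x + y)) * (x - y).
  by rewrite /quad_flux; field.
rewrite normrM ler_piMl// ler_norml.
(* The cofactor of [x - y] is a quadratic form with values between 0 and 1/2, minus a term of
   absolute value at most 1/2. *)
have h1 : `|(a + b) / 2 * (x + y)| <= 2^-1 * 1.
  rewrite normrM ler_pM// ler_norml; move: ha hb hx hy =>
    /andP[? ?] /andP[? ?] /andP[? ?] /andP[? ?]; apply/andP; split; lra.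
have sq (z : R) : - 2^-1 <= z <= 2^-1 -> z ^+ 2 <= 4^-1 by move=> /andP[? ?]; nra.
have := sq _ hx; have := sq _ hy; move: h1; rewrite ler_norml => /andP[? ?] ? ?.
have := sqr_ge0 (x - y); have := sqr_ge0 (x + y); rewrite !expr2.
move=> ? ?; apply/andP; split; nra.
Qed.

Lemma chord_convex : convex_function state_space (chord a b).
Proof.
move=> t x y _ _; have s0 : 0 <= t%:num :> R by exact: ge0.
have s1 : t%:num <= 1 :> R by exact: le1.
rewrite convRE /chord.
rewrite (_ : conv t x y = t%:num * (x : R) + (1 - t%:num) * (y : R) :> R)//.
rewrite /unstable.onem; move: (t%:num : R) s0 s1 => s s0 s1.
(* The convexity defect of a monic quadratic is exactly [s * (1 - s) * (x - y) ^+ 2]. *)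
have := mulr_ge0 (mulr_ge0 s0 (_ : 0 <= 1 - s)) (sqr_ge0 (x - y : R)).
by rewrite subr_ge0 => /(_ s1); nra.
Qed.

End pair.
End entropy.

(** * The entropy flux associated with the discretized flux *)

Section entropy_flux.
Context {R : realType} {N : nat}.
Variables (phi : R -> \bar R) (m x0 v0 : 'I_N -> R) (A : R -> R) (kappa : R).
Hypothesis hinit : initial_configuration m x0.
Hypothesis hA : discretized_flux phi m x0 v0 A.
Variables (a b : R) (ha : - 2^-1 <= a <= 2^-1) (hb : - 2^-1 <= b <= 2^-1).

Let psi := psi0 phi m x0 v0.

Lemma theta0 : theta m 0 = - 2^-1.
Proof. by rewrite /theta big_pred0 ?addr0. Qed.

Lemma thetaN : theta m N = 2^-1.
Proof.
case: hinit => _ m1 _; rewrite /theta.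
under eq_bigl do rewrite ltn_ord.
by rewrite m1; field.
Qed.

Lemma theta_homo : {homo theta m : i j / (i <= j)%N >-> i <= j}.
Proof.
case: hinit => m0 _ _ i j ij; rewrite /theta lerD2l.
rewrite big_mkcond [leRHS]big_mkcond; apply: ler_sum => k _.
case: ifPn => [ki|_]; first by rewrite (leq_trans ki ij).
by case: ifPn => // _; exact: ltW.
Qed.

Lemma theta_itv (i : 'I_N.+1) : - 2^-1 <= theta m i <= 2^-1.
Proof. by rewrite -theta0 -thetaN !theta_homo// -ltnS. Qed.

(** A primitive in [s] of the derivative of [chord a b] times that of the flux. The slope of [A] is
    [psi i] on cell [i], which contributes [psi i] times the increment of [chord a b] over the part
    of the cell below [s]; [clamp] selects that part. *)
Definition entropy_flux (s t : R) : R :=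
  \sum_(i < N) psi i * (chord a b (clamp (theta m i) (theta m i.+1) s) -
                        chord a b (theta m i)) +
  2 * kappa * t * quad_flux a b s.

Let clamp_theta (i : 'I_N) (s : R) :
  - 2^-1 <= clamp (theta m i) (theta m i.+1) s <= 2^-1.
Proof.
have /andP[l u] := @clamp_itv R _ _ s (theta_homo (leqnSn i)).
have /andP[l' _] := theta_itv (widen_ord (leqnSn _) i).
have /andP[_ u'] := theta_itv (lift ord0 i).
by rewrite (le_trans l')//= (le_trans u).
Qed.

Lemma entropy_flux_lip (t x y : R) : - 2^-1 <= x <= 2^-1 -> - 2^-1 <= y <= 2^-1 ->
  `|entropy_flux x t - entropy_flux y t| <=
  (\sum_i `|psi i| * 2 + `|2 * kappa * t|) * `|x - y|.
Proof.
move=> hx hy; rewrite /entropy_flux opprD addrACA -sumrB -mulrBr [leRHS]mulrDl.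
rewrite (le_trans (ler_normD _ _))// lerD//; last first.
  by rewrite normrM ler_wpM2l// quad_flux_lip.
rewrite (le_trans (ler_norm_sum _ _ _))// mulr_suml ler_sum// => i _.
rewrite -mulrBr normrM -mulrA ler_wpM2l// opprB addrA subrK.
rewrite (le_trans (chord_lip ha hb (clamp_theta i x) (clamp_theta i y)))//.
by rewrite ler_wpM2l// clamp_lip.
Qed.

Lemma theta_cell (s : R) : - 2^-1 < s < 2^-1 ->
  (forall k, (k <= N)%N -> s != theta m k) ->
  exists i : 'I_N, theta m i < s < theta m i.+1.
Proof.
move=> /andP[ls us] ns.
have ex : exists k, s < theta m k by exists N; rewrite thetaN.
(* The cell of [s] ends at the least index whose [theta] exceeds [s]. *)
case: (ex_minnP ex) => -[|k sk kmin]; first by rewrite theta0 ltNge ltW.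
have kN : (k < N)%N by apply: kmin; rewrite thetaN.
exists (Ordinal kN) => /=; rewrite sk andbT lt_neqAle eq_sym ns ?(ltnW kN)//=.
by rewrite leNgt; apply/negP => /kmin; rewrite ltnn.
Qed.

(** Inside a cell only one summand varies, the others being clamped at an end of their own cell.
    Near [s] all functions involved are thus polynomials, which are differentiated formally. *)
Lemma entropy_flux_derive (s t : R) : - 2^-1 < s < 2^-1 ->
  (forall k, (k <= N)%N -> s != theta m k) ->
  is_derive s 1 (entropy_flux^~ t)
    (derive1 (chord a b) s * derive1 (fun s => A s + kappa * t * s ^+ 2) s).
Proof.
move=> hs ns; have [i /andP[li ui]] := theta_cell hs ns.
have [_ _ AE] := hA.
pose c : {poly R} := ('X - a%:P) * ('X - b%:P).
have -> : derive1 (chord a b) s = (deriv c).[s].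
  have -> : chord a b = (fun z => c.[z]).
    by apply/funext => z; rewrite /chord /c !hornerE.
  by rewrite derive1E (derive_val (is_derive := is_derive_poly c s)).
have nears : \forall z \near s, theta m i < z < theta m i.+1.
  by near=> z; apply/andP; split; near: z; [exact: lt_nbhsr|exact: lt_nbhsl].
pose d : {poly R} := (A (theta m i))%:P + psi i *: ('X - (theta m i)%:P) +
  (kappa * t) *: 'X^2.
have -> : derive1 (fun s => A s + kappa * t * s ^+ 2) s = (deriv d).[s].
  rewrite derive1E (@near_eq_derive R R R _ (fun z => d.[z])).
    by rewrite (derive_val (is_derive := is_derive_poly d s)).
  apply: filterS nears => z /andP[lz uz].
  by rewrite (AE i z) ?(ltW lz) ?(ltW uz)// /d !hornerE.
pose K := \sum_(j < N | j != i) psi j *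
  (chord a b (clamp (theta m j) (theta m j.+1) s) - chord a b (theta m j)).
pose q : {poly R} := K%:P + psi i *: (c - (c.[theta m i])%:P) +
  (2 * kappa * t) *: ((2 / 3) *: 'X^3 - ((a + b) / 2) *: 'X^2).
apply: (@near_eq_is_derive R R R (fun z => q.[z])).
  apply: filterS nears => z /andP[lz uz].
  rewrite /entropy_flux (bigD1 i)//= clamp_id ?(ltW lz) ?(ltW uz)//.
  rewrite (_ : \sum_(j < N | j != i) _ = K).
    by rewrite /q /c !hornerE /quad_flux /chord /=; field.
  apply: eq_bigr => j ji; congr (_ * (chord a b _ - _)).
  have hj := theta_homo (leqnSn j).
  move: ji; rewrite -(inj_eq val_inj) neq_ltn => /orP[/theta_homo ji|/theta_homo ij].
    by rewrite !clamp_right// (le_trans ji)// ltW.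
  by rewrite !clamp_left// (le_trans _ ij)// ltW.
apply: (is_derive_eq (is_derive_poly q s)).
by rewrite /q /c /d !poly.derivE !hornerE /=; field.
Unshelve. all: by end_near. Qed.

Lemma entropy_flux_pair (T : R) :
  entropy_pair (fun s t => A s + kappa * t * s ^+ 2) T (chord a b) entropy_flux.
Proof.
split; first exact: chord_convex.
  apply: (@lipschitzI _ _ _ 2) => x y /state_spaceP hx /state_spaceP hy.
  exact: chord_lip.
move=> t _; split.
  apply: lipschitzI => x y /state_spaceP hx /state_spaceP hy.
  exact: entropy_flux_lip.
(* The excluded states are the finitely many possible kinks of [A], a null set. *)
have ctheta : countable (range (fun k : 'I_N.+1 => theta m k)).
  by apply/finite_set_countable/finite_image/finite_finset.
exists (range (fun k : 'I_N.+1 => theta m k)); split.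
- exact: countable_measurable.
- exact: countable_lebesgue_measure0.
move=> s /= H; apply: contrapT => ns; apply: H => hs.
apply: entropy_flux_derive => // k kN; apply/negP => /eqP sk; apply: ns.
by exists (inord k); rewrite ?inordK.
Qed.

(** The quadratic part contributes exactly [kappa * t * (b - a) ^+ 3 / 3], while each cell
    contributes at most [2 * |psi i|] in absolute value, uniformly in time. *)
Lemma entropy_flux_jump (t : R) : 0 <= kappa * t -> a <= b ->
  kappa * t * (b - a) ^+ 3 / 3 - 2 * \sum_i `|psi i| <=
  entropy_flux b t - entropy_flux a t.
Proof.
move=> kt ab; rewrite /entropy_flux opprD addrACA -sumrB -mulrBr.
have -> : 2 * kappa * t * (quad_flux a b b - quad_flux a b a) =
    kappa * t * (b - a) ^+ 3 / 3 by rewrite /quad_flux; field.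
rewrite addrC lerD2l -mulNr mulr_sumr ler_sum// => i _.
rewrite -mulrBr opprB addrA subrK.
have := chord_lip ha hb (clamp_theta i b) (clamp_theta i a).
have := clamp_lip (theta m i) (theta m i.+1) b a.
rewrite (ger0_norm (_ : 0 <= b - a)) ?subr_ge0//.
set u := chord a b _ - _; set w := `|clamp _ _ _ - _|.
(* [chord a b] has Lipschitz constant 2 and two states differ by at most 1. *)
move=> w1 uw; have u2 : `|u| <= 2.
  by move: ha hb => /andP[? ?] /andP[? ?]; lra.
rewrite mulNr lerNl (le_trans (ler_norm _))// normrN normrM mulrC ler_wpM2r//.
Qed.

End entropy_flux.

(** * Isolated clusters *)

Section clusters.
Context {R : realType} {N : nat}.

Definition cdf_atoms (m y : 'I_N -> R) : seq (R * R) :=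
  [seq (m i, y i) | i <- index_enum 'I_N].

Lemma empirical_cdfE (m y : 'I_N -> R) :
  empirical_cdf m y = fun x => - 2^-1 + step (cdf_atoms m y) x.
Proof. by apply/funext => x; rewrite /step big_map. Qed.

(* With [S = empirical_cdf + 1/2], [chord a b (empirical_cdf)] is
   [S ^+ 2 - (a + b + 1) * S] up to a constant, and a product of two Heaviside
   steps jumps at the larger of the two positions. *)
Definition chord_atoms_pos (m y : 'I_N -> R) : seq (R * R) :=
  [seq (m ij.1 * m ij.2, Num.max (y ij.1) (y ij.2)) |
    ij <- index_enum ('I_N * 'I_N)%type].

(** These weights are nonnegative when [a] and [b] are states; the minus sign is kept apart so that
    both lists define measures. *)
Definition chord_atoms_neg (a b : R) (m y : 'I_N -> R) : seq (R * R) :=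
  [seq ((a + b + 1) * m i, y i) | i <- index_enum 'I_N].

Lemma heavisideM (x y z : R) :
  heaviside (x - y) * heaviside (x - z) = heaviside (x - Num.max y z).
Proof.
rewrite /heaviside !subr_ge0 ge_max.
by case: (y <= x); case: (z <= x); rewrite /= ?mulr1 ?mulr0.
Qed.

Lemma chord_empirical_cdf (a b : R) (m y : 'I_N -> R) (x : R) :
  chord a b (empirical_cdf m y x) = chord a b (- 2^-1) +
    step (chord_atoms_pos m y ++
          [seq (- p.1, p.2) | p <- chord_atoms_neg a b m y]) x.
Proof.
rewrite /step big_cat /= !big_map /=.
rewrite -(pair_bigA _ (fun i j => m i * m j * heaviside (x - Num.max (y i) (y j)))) /=.
rewrite /empirical_cdf; set S := \sum_i m i * heaviside (x - y i).
have -> : \sum_i \sum_j m i * m j * heaviside (x - Num.max (y i) (y j)) = S * S.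
  rewrite mulr_suml; apply: eq_bigr => i _; rewrite mulr_sumr.
  by apply: eq_bigr => j _; rewrite -heavisideM; ring.
have -> : \sum_i - ((a + b + 1) * m i) * heaviside (x - y i) = - (a + b + 1) * S.
  by rewrite mulr_sumr; apply: eq_bigr => i _; ring.
by rewrite /chord; field.
Qed.

Lemma empirical_cdf_derivative (m y : 'I_N -> R)
    (mu : {finite_measure set R -> \bar R}) :
  (forall f : R -> R, measurable_fun setT f ->
    \int[mu]_x f x = \sum_(p <- cdf_atoms m y) p.1 * f p.2) ->
  distributional_derivative (empirical_cdf m y) mu mzero.
Proof.
move=> muE psi tpsi; rewrite empirical_cdfE.
have [_ ->] := step_derive (cdf_atoms m y) (- 2^-1) tpsi.
rewrite muE; last exact: test_function_measurable.
by rewrite [X in _ - X]/Rintegral integral_measure_zero subr0.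
Qed.

Lemma chord_empirical_cdf_derivative (a b : R) (m y : 'I_N -> R)
    (nup nun : {finite_measure set R -> \bar R}) :
  (forall f : R -> R, measurable_fun setT f ->
    \int[nup]_x f x = \sum_(p <- chord_atoms_pos m y) p.1 * f p.2) ->
  (forall f : R -> R, measurable_fun setT f ->
    \int[nun]_x f x = \sum_(p <- chord_atoms_neg a b m y) p.1 * f p.2) ->
  distributional_derivative (fun x => chord a b (empirical_cdf m y x)) nup nun.
Proof.
move=> nupE nunE psi tpsi; have mpsi := test_function_measurable tpsi.
under eq_Rintegral do rewrite chord_empirical_cdf.
have [_ ->] := step_derive (chord_atoms_pos m y ++
  [seq (- p.1, p.2) | p <- chord_atoms_neg a b m y]) (chord a b (- 2^-1)) tpsi.
rewrite nupE// nunE// big_cat /=; congr (- (_ + _)).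
by rewrite !big_map -sumrN; apply: eq_bigr => i _; rewrite mulNr.
Qed.

Section isolated_cluster.
Variables (m y : 'I_N -> R) (l r Y : R) (L J : {set 'I_N}).
Hypotheses (yJ : {in J, forall j, y j = Y}) (yL : {in L, forall j, y j <= l})
  (yr : forall j, j \notin J -> j \notin L -> r <= y j) (lYr : l < Y < r).

Let a := - 2^-1 + \sum_(j in L) m j.
Let b := - 2^-1 + \sum_(j in L :|: J) m j.

Let LJ : fintype.disjoint (mem L) (mem J).
Proof.
apply/pred0P => j /=; apply/negP => /andP[/yL + /yJ yj].
by rewrite yj; case/andP: lYr => lY _; rewrite leNgt lY.
Qed.

(** Within the window the agents of [L] count fully and those outside [L] and [J] not at all, which
    leaves a single jump at [Y]. *)
Lemma isolated_cluster_cdf x : l < x < r ->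
  empirical_cdf m y x = a + (b - a) * heaviside (x - Y).
Proof.
move=> /andP[lx xr]; rewrite /a /b /empirical_cdf.
have -> : \sum_(j in L :|: J) m j = \sum_(j in L) m j + \sum_(j in J) m j.
  by rewrite -bigU//; apply: eq_bigl => j; rewrite !inE.
rewrite -addrA; congr (_ + _).
rewrite opprD addrACA subrr add0r addrAC subrr add0r.
rewrite (bigID (mem L))/=; congr (_ + _).
  apply: eq_bigr => j /yL yj; rewrite /heaviside subr_ge0 ifT ?mulr1//.
  by rewrite (le_trans yj)// ltW.
rewrite (bigID (mem J))/= [X in _ + X]big1 ?addr0.
  rewrite mulr_suml; apply: eq_big => [j|j /andP[_ /yJ ->]]//.
  by case: (boolP (j \in J)) => jJ; rewrite ?andbF ?andbT//;
     apply/negP => /(disjointFr LJ); rewrite jJ.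
move=> j /andP[jL jJ]; rewrite /heaviside subr_ge0 ifN ?mulr0// -ltNge.
by rewrite (lt_le_trans xr)// yr.
Qed.

(** The entropy vanishes on both sides of the jump, so its derivative has no net mass in the window.
    On the atoms this is the factorization of [(b + 1/2) ^+ 2 - (a + 1/2) ^+ 2] as
    [(a + b + 1) * (b - a)]. *)
Lemma isolated_cluster_atoms (g : R -> R) : (forall x, ~~ (l < x < r) -> g x = 0) ->
  \sum_(p <- chord_atoms_pos m y) p.1 * g p.2 =
  \sum_(p <- chord_atoms_neg a b m y) p.1 * g p.2.
Proof.
move=> g0; rewrite !big_map /=.
pose al i : R := (i \in L :|: J)%:R; pose la i : R := (i \in L)%:R.
have gl x : x <= l -> g x = 0 by move=> xl; apply: g0; rewrite negb_and -leNgt xl.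
have gr x : r <= x -> g x = 0.
  by move=> rx; apply: g0; rewrite negb_and -!leNgt rx orbT.
have [lY Yr] := andP lYr.
(* The larger position lies in the window exactly when both agents are in [L :|: J] but not both in
   [L], and it is then [Y]; the difference of products is the indicator of this event. *)
have gmax i j : g (Num.max (y i) (y j)) = g Y * (al i * al j - la i * la j).
  rewrite /al /la !inE.
  case: (boolP (i \in L)) => iL; case: (boolP (j \in L)) => jL /=.
  - by rewrite gl ?ge_max ?yL// !mulr1 subrr mulr0.
  - case: (boolP (j \in J)) => [/yJ ->|jJ] /=; first last.
      by rewrite !mulr0 subr0 mulr0 gr// le_max (yr jJ jL) orbT.
    by rewrite max_r ?mulr1 ?mulr0 ?subr0 ?mulr1// (le_trans (yL iL))// ltW.
  - case: (boolP (i \in J)) => [/yJ ->|iJ] /=; first last.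
      by rewrite !mul0r subr0 mulr0 gr// le_max (yr iJ iL).
    by rewrite max_l ?mul0r ?mulr1 ?subr0 ?mulr1// (le_trans (yL jL))// ltW.
  case: (boolP (i \in J)) => [/yJ ->|iJ] /=; first last.
    by rewrite !mul0r subr0 mulr0 gr// le_max (yr iJ iL).
  case: (boolP (j \in J)) => [/yJ ->|jJ] /=; first last.
    by rewrite !mulr0 subr0 mulr0 gr// le_max (yr jJ jL) orbT.
  by rewrite maxxx mulr1 mulr0 subr0 mulr1.
have gy i : g (y i) = g Y * (al i - la i).
  rewrite -{1}(maxxx (y i)) gmax /al /la; congr (_ * (_ - _)).
    by case: (_ \in _); rewrite ?mulr1 ?mulr0.
  by case: (_ \in _); rewrite ?mulr1 ?mulr0.
rewrite -(pair_bigA _ (fun i j => m i * m j * g (Num.max (y i) (y j)))) /=.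
have sa : \sum_i m i * al i = b + 2^-1.
  rewrite /b addrAC addNr add0r [RHS]big_mkcond; apply: eq_bigr => i _.
  by rewrite /al; case: ifP; rewrite ?mulr1 ?mulr0.
have sl : \sum_i m i * la i = a + 2^-1.
  rewrite /a addrAC addNr add0r [RHS]big_mkcond; apply: eq_bigr => i _.
  by rewrite /la; case: ifP; rewrite ?mulr1 ?mulr0.
transitivity (g Y * ((\sum_i m i * al i) * (\sum_i m i * al i) -
                     (\sum_i m i * la i) * (\sum_i m i * la i))).
  rewrite !mulr_suml -sumrB mulr_sumr; apply: eq_bigr => i _.
  rewrite !mulr_sumr -sumrB mulr_sumr; apply: eq_bigr => j _.
  by rewrite gmax; ring.
transitivity ((a + b + 1) * g Y * (\sum_i m i * al i - \sum_i m i * la i)).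
  by rewrite sa sl; field.
by rewrite -sumrB mulr_sumr; apply: eq_bigr => i _; rewrite gy; ring.
Qed.

End isolated_cluster.

(** Cluster sizes are bounded by [N]. At a time after [T] where the largest size is attained,
    sticking turns later inclusions into equalities. *)
Lemma cluster_eventually_constant (x : 'I_N -> R -> R) (i : 'I_N) (T : R) :
  0 <= T ->
  (forall s t, 0 <= s -> s <= t -> colocated x s i \subset colocated x t i) ->
  exists2 t0, T <= t0 & forall t, t0 <= t -> colocated x t i = colocated x t0 i.
Proof.
move=> T0 stick.
pose P k := `[< exists2 t, T <= t & #|colocated x t i| = k >].
have exP : exists k, P k by exists #|colocated x T i|; apply/asboolP; exists T.
have ubP k : P k -> (k <= N)%N.
  by move=> /asboolP[t _ <-]; rewrite -[N in leqRHS]card_ord max_card.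
case: (ex_maxnP exP ubP) => k /asboolP[t0 Tt0 ct0] kmax; exists t0 => // t t0t.
apply/esym/eqP; rewrite eqEcard stick ?(le_trans T0)//= ct0.
by apply: kmax; apply/asboolP; exists t => //; exact: le_trans t0t.
Qed.

(** The factor 4 provides room for a window of half-width [2 * e] around the cluster: displacements
    below [e] keep the cluster at distance [e] from its ends and all other agents outside. *)
Lemma isolating_window (x : 'I_N -> R -> R) (i : 'I_N) (t1 : R) :
  (forall j, {for t1, continuous (x j)}) ->
  exists2 e, 0 < e & exists2 d, 0 < d &
    (forall j, j \notin colocated x t1 i -> 4 * e <= `|x j t1 - x i t1|) /\
    (forall j t, `|t - t1| < d -> `|x j t - x j t1| < e).
Proof.
move=> cx.
have [e e0 He] : exists2 e : R, 0 < e &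
    forall j, j \notin colocated x t1 i -> 4 * e <= `|x j t1 - x i t1|.
  (* The default 1 keeps the minimum positive when every agent is in the cluster. *)
  exists (\big[Num.min/1]_(j | j \notin colocated x t1 i) (`|x j t1 - x i t1| / 4)).
    apply: lt_bigmin => // j; rewrite inE => ji.
    by rewrite divr_gt0// normr_gt0 subr_eq0.
  move=> j ji; rewrite mulrC -ler_pdivlMr//.
  exact: (@bigmin_le_cond _ _ _ 1 j (fun j => j \notin colocated x t1 i)
    (fun j => `|x j t1 - x i t1| / 4)).
exists e => //.
have near_x j : \forall t \near t1, `|x j t - x j t1| < e.
  by have /cvgrPdistC_lt := cx j; apply.
have /(_ _ near_x)/nbhs_normP[d /= d0 Hd] :=
  @filter_forall R 'I_N _ _ (nbhs_filter t1).
exists d => //; split=> // j t tt1.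
by apply: Hd; rewrite /ball /= distrC.
Qed.

End clusters.

(** * Entropy production at a fixed time *)

Section production.
Context {R : realType} {N : nat}.

(** [zt] and [zt'] stand for the temporal factor of the test function and its derivative. The
    entropy is 0 in the window, which removes the [zt'] term, and the terms in [V] cancel for any
    measurable [V]; the jump of [q] remains. *)
Lemma isolated_cluster_production (m y : 'I_N -> R) (l r Y a b : R)
    (L J : {set 'I_N}) (nup nun : {finite_measure set R -> \bar R})
    (V q : R -> R) (zt zt' : R) :
  {in J, forall j, y j = Y} -> {in L, forall j, y j <= l} ->
  (forall j, j \notin J -> j \notin L -> r <= y j) -> l < Y < r ->
  a = - 2^-1 + \sum_(j in L) m j -> b = - 2^-1 + \sum_(j in L :|: J) m j ->
  measurable_fun setT V ->
  (forall f : R -> R, measurable_fun setT f ->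
    \int[nup]_x f x = \sum_(p <- chord_atoms_pos m y) p.1 * f p.2) ->
  (forall f : R -> R, measurable_fun setT f ->
    \int[nun]_x f x = \sum_(p <- chord_atoms_neg a b m y) p.1 * f p.2) ->
  \int[lebesgue_measure]_x
    (chord a b (empirical_cdf m y x) * (smooth_bump l r x * zt') +
     q (empirical_cdf m y x) * (smooth_bump' l r x * zt)) +
  (\int[nup]_x (V x * (smooth_bump l r x * zt)) -
   \int[nun]_x (V x * (smooth_bump l r x * zt))) =
  - ((q b - q a) * smooth_bump l r Y * zt).
Proof.
move=> yJ yL yr lYr aE bE mV nupE nunE.
have mg : measurable_fun setT (fun x => V x * (smooth_bump l r x * zt)).
  apply: measurable_funM => //; apply: measurable_funM => //.
  exact: smooth_bump_measurable.
have g0 x : ~~ (l < x < r) -> V x * (smooth_bump l r x * zt) = 0.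
  by move=> /smooth_bump_out ->; rewrite mul0r mulr0.
have := isolated_cluster_atoms m yJ yL yr lYr g0.
rewrite nupE// nunE// -aE -bE => ->; rewrite subrr addr0.
(* In the window [q] of the distribution is a one-step function; elsewhere the derivative of the
   bump vanishes, so the integrals agree. *)
pose s := [:: ((q b - q a) * zt, Y)].
have [_ I] := step_derive s (q a * zt) (test_function_bump1 l r).
rewrite /s big_seq1 /= in I.
rewrite (_ : - _ = - ((q b - q a) * zt * smooth_bump l r Y)); last by rewrite mulrAC.
rewrite -I; apply: eq_Rintegral => x _.
rewrite /step big_seq1 /= derive1_bump.
have [lxr|nlxr] := boolP (l < x < r); last first.
  by rewrite smooth_bump_out// smooth_bump'_out// !mul0r !mulr0 addr0.
rewrite (isolated_cluster_cdf m yJ yL yr lYr lxr) -aE -bE /heaviside.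
case: ifPn => _; rewrite ?mulr1 ?mulr0 ?addr0.
  by rewrite [a + (b - a)]addrC subrK /chord; ring.
by rewrite /chord; ring.
Qed.

(** This covers the times outside the temporal bump, where the cluster need not be isolated. *)
Lemma vanishing_production (m y : 'I_N -> R) (l r a b : R)
    (nup nun : {finite_measure set R -> \bar R}) (V q : R -> R) :
  \int[lebesgue_measure]_x
    (chord a b (empirical_cdf m y x) * (smooth_bump l r x * 0) +
     q (empirical_cdf m y x) * (smooth_bump' l r x * 0)) +
  (\int[nup]_x (V x * (smooth_bump l r x * 0)) -
   \int[nun]_x (V x * (smooth_bump l r x * 0))) = 0.
Proof.
under eq_Rintegral do rewrite !mulr0 addr0.
under [X in _ + (X - _)]eq_Rintegral do rewrite !mulr0.
under [X in _ + (_ - X)]eq_Rintegral do rewrite !mulr0.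
by rewrite /Rintegral !integral0 subrr addr0.
Qed.

End production.

(** * Contradiction at a late isolated cluster *)

Theorem theorem6p1 (R : realType) (phi : R -> \bar R) (kappa : R) (N : nat)
    (m x0 v0 : 'I_N -> R) (x v : 'I_N -> R -> R) (A : R -> R)
    (hphi : protocol phi) (hkappa : 0 < kappa)
    (hinit : initial_configuration m x0)
    (hsticky : sticky_particle_solution phi kappa m x0 v0 x v)
    (hA : discretized_flux phi m x0 v0 A) :
  ~ global_entropy_solution phi
      (fun s t => A s + kappa * t * s ^+ 2)
      (fun y t => empirical_cdf m (x^~ t) y)
      (empirical_cdf m x0).
Proof.
move=> ent; have [m0 m1 _] := hinit.
(* The masses sum to 1, so there is at least one agent. *)
have [i0 _] : exists i0 : 'I_N, True.
  case: N m m1 {x0 v0 x v hinit hsticky hA m0 ent} => [|n] m m1; last by exists ord0.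
  by move: m1; rewrite big_ord0 => /eqP; rewrite eq_sym oner_eq0.
pose S : R := 2 * \sum_i `|psi0 phi m x0 v0 i|.
have S0 : 0 <= S by rewrite mulr_ge0// sumr_ge0.
(* At time [T1] a jump of size [m i0] gives [kappa * T1 * m i0 ^+ 3 / 3 = S + 1], one more than the
   bound [S] on the piecewise linear contribution. *)
pose T1 : R := 3 * (S + 1) / (kappa * m i0 ^+ 3).
have km0 : 0 < kappa * m i0 ^+ 3 by rewrite mulr_gt0// exprn_gt0.
have T10 : 0 <= T1 by rewrite divr_ge0 ?(ltW km0)// mulr_ge0// addr_ge0.
have [t0 T1t0 Jconst] := cluster_eventually_constant T10 (sticky_sticks hsticky i0).
have t00 : 0 <= t0 by exact: le_trans T1t0.
(* With a radius of at most 1/2, the time window around [t1] stays after [t0], where the cluster is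
   constant. *)
pose t1 : R := t0 + 1; have t10 : 0 < t1 by rewrite ltr_wpDl.
have cx j (t : R) : 0 < t -> {for t, continuous (x j)}.
  move=> t_gt0; have /continuous_within_itvcyP[c _] :=
    @sticky_x_continuous _ _ _ _ _ _ _ _ _ hsticky j.
  by apply: c; rewrite in_itv/= t_gt0.
have [e e0 [d0 d00 [far near0]]] := isolating_window i0 (fun j => cx j t1 t10).
pose d : R := Num.min d0 2^-1; have d_gt0 : 0 < d by rewrite lt_min d00 invr_gt0/=.
have d1 : d <= 2^-1 by rewrite ge_min lexx orbT.
have near_x j (t : R) : `|t - t1| < d -> `|x j t - x j t1| < e.
  by move=> /lt_le_trans h; apply/near0/h; rewrite ge_min lexx.
set J := colocated x t1 i0 in far.
(* [J] and [L] are frozen at [t1]; the [window_] facts show that they describe the configuration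
   throughout the time window, so [a] and [b] do not depend on time. *)
pose X : R := x i0 t1; pose L := [set j | x j t1 < X]%SET.
pose a : R := - 2^-1 + \sum_(j in L) m j.
pose b : R := - 2^-1 + \sum_(j in L :|: J) m j.
pose l : R := X - 2 * e; pose r : R := X + 2 * e.
have window_t (t : R) : `|t - t1| < d -> t0 < t.
  by rewrite ltr_norml /t1 => /andP[h _]; lra.
have window_J (t : R) : `|t - t1| < d -> {in J, forall j, x j t = x i0 t}.
  move=> ht j; rewrite /J (Jconst t1) ?lerDl// -(Jconst t (ltW (window_t _ ht))).
  by rewrite inE => /eqP.
have window_L (t : R) : `|t - t1| < d -> {in L, forall j, x j t <= l}.
  move=> ht j; rewrite inE => jX; have jJ : j \notin J by rewrite inE lt_eqF.
  have := far j jJ; have := near_x j t ht; rewrite ltr_norml => /andP[_ h].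
  by rewrite ltr0_norm ?subr_lt0// /l /X => h'; lra.
have window_r (t : R) : `|t - t1| < d ->
    forall j, j \notin J -> j \notin L -> r <= x j t.
  move=> ht j jJ; rewrite inE -leNgt => jX.
  have := far j jJ; have := near_x j t ht; rewrite ltr_norml => /andP[h _].
  by rewrite ger0_norm ?subr_ge0// /r /X => h'; lra.
have window_Y (t : R) : `|t - t1| < d -> l + e <= x i0 t <= r - e.
  move=> ht; have := near_x i0 t ht; rewrite ltr_norml => /andP[h h'].
  by rewrite /l /r /X; apply/andP; split; lra.
have sum_le (P : {set 'I_N}) : 0 <= \sum_(j in P) m j <= 1.
  rewrite sumr_ge0 => [|j _]; last exact: ltW.
  by rewrite -m1 [leRHS](bigID (mem P))/= lerDl sumr_ge0// => j _; exact: ltW.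
have ha : - 2^-1 <= a <= 2^-1.
  by have /andP[h h'] := sum_le L; rewrite /a; apply/andP; split; lra.
have hb : - 2^-1 <= b <= 2^-1.
  by have /andP[h h'] := sum_le (L :|: J)%SET; rewrite /b; apply/andP; split; lra.
have ab : m i0 <= b - a.
  rewrite /b /a opprD addrACA subrr add0r.
  have iJ : i0 \in (L :|: J)%SET by rewrite !inE eqxx orbT.
  rewrite (bigID (mem L))/= [X in X + _ - _](_ : _ = \sum_(j in L) m j).
    rewrite addrAC subrr add0r (bigD1 i0)/=; last by rewrite iJ inE ltxx.
    by rewrite lerDl sumr_ge0// => j _; exact: ltW.
  by apply: eq_bigl => j; rewrite !inE; case: (_ < _); rewrite ?andbF.
pose q := entropy_flux phi m x0 v0 kappa a b.
have jump (t : R) : t0 < t -> 1 <= q b t - q a t.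
  move=> t0t; have t_ge0 : 0 <= t by rewrite (le_trans t00)// ltW.
  have ab0 : a <= b by rewrite -subr_ge0 (le_trans _ ab)// ltW.
  have := entropy_flux_jump phi v0 hinit ha hb (mulr_ge0 (ltW hkappa) t_ge0) ab0.
  apply: le_trans.
  have : 3 * (S + 1) <= kappa * t * (b - a) ^+ 3.
    have -> : 3 * (S + 1) = kappa * T1 * m i0 ^+ 3.
      by rewrite /T1; field; rewrite !gt_eqF.
    apply: ler_pM.
    - by rewrite mulr_ge0// ltW.
    - by rewrite exprn_ge0// ltW.
    - by rewrite ler_pM2l// (le_trans T1t0)// ltW.
    by rewrite lerXn2r ?nnegrE ?(ltW (m0 _)) ?subr_ge0.
  by rewrite /S; lra.
pose T : R := t1 + 2; have T0 : 0 < T by rewrite /T; lra.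
have [[_ ineq _ _] _] := ent T T0.
have atoms0 y : all (fun p => 0 <= p.1) (cdf_atoms m y).
  by apply/allP => p /mapP[i _ ->] /=; exact: ltW.
have pos0 y : all (fun p => 0 <= p.1) (chord_atoms_pos m y).
  by apply/allP => p /mapP[i _ ->] /=; rewrite mulr_ge0// ltW.
have neg0 y : all (fun p => 0 <= p.1) (chord_atoms_neg a b m y).
  apply/allP => p /mapP[i _ ->] /=; rewrite mulr_ge0//; last exact: ltW.
  by move: ha hb => /andP[? ?] /andP[? ?]; lra.
(* Explicit atomic derivatives, chosen time by time, are supplied to the entropy inequality. *)
have [mu muE] := choice (fun t : R => atomic_measure (atoms0 (x^~ t))).
have [nup nupE] := choice (fun t : R => atomic_measure (pos0 (x^~ t))).
have [nun nunE] := choice (fun t : R => atomic_measure (neg0 (x^~ t))).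
pose zeta (p : R * R) := smooth_bump l r p.1 * smooth_bump (t1 - d) (t1 + d) p.2.
have tz : test_function [set p : R * R | 0 < p.2 < T] zeta.
  apply: test_function_bump => -[y t] [/= _]; rewrite in_itv/= => /andP[h h'].
  by rewrite /T; apply/andP; split; rewrite /t1 in h h' *; lra.
have z0 p : 0 <= zeta p by rewrite mulr_ge0// smooth_bump_ge0.
have := ineq _ _ (entropy_flux_pair kappa hinit hA ha hb T) zeta tz z0 mu nup nun
  (fun t _ => empirical_cdf_derivative (muE t))
  (fun t _ => chord_empirical_cdf_derivative (nupE t) (nunE t)).
pose h (t : R) := (q b t - q a t) * smooth_bump l r (x i0 t) *
  smooth_bump (t1 - d) (t1 + d) t.
(* At every time the spatial terms collapse to [- h t], by the isolated cluster inside the temporal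
   window and by vanishing factors outside. *)
rewrite [X in 0 <= X](_ : _ =
    \int[lebesgue_measure]_(t in `]0, T[) (-1 * h t)); last first.
  apply: eq_Rintegral => t _; rewrite mulN1r.
  under eq_Rintegral do rewrite derive_bump_space derive_bump_time.
  have [tw|ntw] := boolP (t1 - d < t < t1 + d); last first.
    rewrite /zeta /h /= (smooth_bump_out ntw) (smooth_bump'_out ntw) mulr0 oppr0.
    exact: (vanishing_production _ _ _ _ _ _ _ _ _ (fun s => q s t)).
  have ht : `|t - t1| < d by rewrite ltr_distl.
  have Yw : l < x i0 t < r.
    by have /andP[? ?] := window_Y t ht; apply/andP; split; lra.
  apply: (isolated_cluster_production (fun s => q s t) _ _ (window_J t ht)
    (window_L t ht) (window_r t ht) Yw erefl erefl _ (nupE t) (nunE t)).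
  exact: (measurable_nonlocal_velocity hphi (muE t)).
have ih : lebesgue_measure.-integrable `]0, T[ (EFin \o h).
  pose k : R := 2 * kappa * (quad_flux a b b - quad_flux a b a).
  (* The jump of the entropy flux is affine in time, which makes [h] measurable and bounded on the
     time interval. *)
  have qE t : q b t - q a t = (q b 0 - q a 0) + k * t.
    by rewrite /q /entropy_flux /k; ring.
  apply: measurable_bounded_integrable => //.
  - by rewrite /= lebesgue_measure_itv/= lte_fin T0 ltry.
  - apply: measurable_funM; last first.
      by apply: measurable_funTS; exact: smooth_bump_measurable.
    apply: measurable_funM.
      apply: (@eq_measurable_fun _ _ _ _ _ (fun t => q b 0 - q a 0 + k * t)).
        by move=> t _; rewrite -qE.
      by apply: measurable_funD => //; apply: measurable_funM.
    apply: (measurableT_comp (smooth_bump_measurable l r)).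
    apply: subspace_continuous_measurable_fun => //.
    have sub : ([set` `]0, T[] : set R) `<=` [set` `[0, +oo[].
      by apply: subset_itv; rewrite bnd_simp.
    exact: (continuous_subspaceW sub
      (@sticky_x_continuous _ _ _ _ _ _ _ _ _ hsticky i0)).
  exists (`|q b 0 - q a 0| + `|k| * T); split=> [|M CM t /=]; first exact: num_real.
  rewrite in_itv/= => /andP[t_gt0 tT]; apply: le_trans (ltW CM).
  rewrite /h 2!normrM !(ger0_norm (smooth_bump_ge0 _ _ _)).
  rewrite -mulrA (le_trans (ler_piMr _ _))//.
    by rewrite mulr_ile1 ?smooth_bump_ge0 ?smooth_bump_le1.
  rewrite qE (le_trans (ler_normD _ _))// lerD2l normrM (ger0_norm (ltW t_gt0)).
  by rewrite ler_wpM2l// ltW.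
rewrite RintegralZl// mulN1r oppr_ge0 leNgt => /negP; apply.
(* On the middle half of the time window the jump is at least 1, the spatial bump at least
   [flat 1 e ^+ 2] and the temporal one at least [flat 1 (d / 2) ^+ 2]. *)
apply: (@Rintegral_itv_gt0 _ T (t1 - d / 2) (t1 + d / 2)
  (flat 1 e ^+ 2 * flat 1 (d / 2) ^+ 2)) ih _ _.
- by rewrite /t1; lra.
- by lra.
- by rewrite /T; lra.
- by rewrite mulr_gt0// exprn_gt0// flat1_gt0// divr_gt0.
- move=> t _; rewrite /h; have [tw|/smooth_bump_out ->] := boolP (t1 - d < t < t1 + d).
    have ht : `|t - t1| < d by rewrite ltr_distl.
    apply: mulr_ge0 (smooth_bump_ge0 _ _ _).
    apply: mulr_ge0 (smooth_bump_ge0 _ _ _).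
    exact: le_trans (jump _ (window_t _ ht)).
  by rewrite mulr0.
move=> t /andP[h1 h2].
have ht : `|t - t1| < d by rewrite ltr_distl; apply/andP; split; lra.
rewrite /h ler_pM ?exprn_ge0 ?flat1_ge0//; last by apply: smooth_bump_lb; lra.
have /andP[Y1 Y2] := window_Y t ht.
rewrite -[leLHS]mul1r ler_pM ?exprn_ge0 ?flat1_ge0 ?smooth_bump_lb//.
exact: jump (window_t _ ht).
Qed.
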